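(* Let $d\ge2$, $k\ge1$, $m\ge0$ be integers, $L\ge1$. For $s\in\mathbb R^d$ let $D_s=\bigcup_{j=1}^pD^j_s$ ($p\ge0$; $D_s=\emptyset$ if $p=0$), where $D^j_s=\{z=(s_1,\dots,s_k)\in\mathbb R^{kd}: c^j_0s+\sum_{i=1}^kc^j_is_i=0\}$ with real $c^j_i$ and $(c^j_1,\dots,c^j_k)\ne0$. Let $G_s(z,\theta;\nu)$ be measurable in $(z,\theta,\nu)\in\mathbb R^{kd}\times\mathbb R^m\times(0,1/2]$, $C^2$ in $z$, and satisfy $$|\partial^\alpha_zG_s(z,\theta;\nu)|\le\nu^{-|\alpha|}C^\#(s)C^\#(z)C^\#(\theta)\qquad\text{for }0\le|\alpha|\le2$$ for all values of the arguments. Put $$S_s=\int_{\mathbb R^m}L^{-kd}\sum_{z\in(\mathbb Z^d_L)^k\setminus D_s}G_s(z,\theta;\nu)\,d\theta,\qquad J_s=\int_{\mathbb R^m}\int_{\mathbb R^{kd}}G_s(z,\theta;\nu)\,dz\,d\theta$$ (no $\theta$-integration if $m=0$). Then $|S_s-J_s|\le C^\#(s)\nu^{-2}L^{-2}$ for all $s\in\mathbb R^d$.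
   Context: $\mathbb Z^d_L=L^{-1}\mathbb Z^d$, $\langle x\rangle=(1+|x|^2)^{1/2}$. $C^\#(\cdot)$ denotes (possibly different) nonnegative continuous functions with $C^\#(x)\le C_N\langle x\rangle^{-N}$ for every $N$; the function in the conclusion does not depend on $\nu$ and $L$. *)

(* Defs.v *)
From HB Require Import structures.
From mathcomp Require Import all_boot all_order all_algebra.
From mathcomp Require Import all_classical all_reals all_analysis.
Set Implicit Arguments. Unset Strict Implicit. Unset Printing Implicit Defensive.
Import Order.TTheory GRing.Theory Num.Theory.
Import numFieldNormedType.Exports.
Local Open Scope classical_set_scope.
Local Open Scope ring_scope.

Section Defs.
Variable R : realType.

Definition jbr (p q : nat) (x : 'M[R]_(p, q)) : R :=
  Num.sqrt (1 + \sum_(i < p) \sum_(j < q) x i j ^+ 2).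

Definition Csharp (p q : nat) (C : 'M[R]_(p, q) -> R) : Prop :=
  continuous C /\ (forall x, 0 <= C x) /\
  (forall N : nat, exists CN : R, forall x, C x * jbr x ^+ N <= CN).

Definition pd (p q : nat) (a : 'I_p * 'I_q) (f : 'M[R]_(p, q) -> R)
  : 'M[R]_(p, q) -> R :=
  fun z => 'D_(delta_mx a.1 a.2) f z.

Definition C2 (p q : nat) (f : 'M[R]_(p, q) -> R) : Prop :=
  continuous f /\
  (forall a z, derivable f z (delta_mx a.1 a.2)) /\
  (forall a, continuous (pd a f)) /\
  (forall a b z, derivable (pd b f) z (delta_mx a.1 a.2)) /\
  (forall a b, continuous (pd a (pd b f))).

(* Lebesgue integral over R^n of f : 'rV_n -> R, as the iterated
   one-dimensional Lebesgue integral (equal to the n-dimensional one for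
   integrable f by Fubini).  For n = 0 there is no integration. *)
Fixpoint Rint_n (n : nat) : ('rV[R]_n -> R) -> R :=
  match n return ('rV[R]_n -> R) -> R with
  | 0 => fun f => f 0
  | n'.+1 => fun f =>
      Rintegral (@lebesgue_measure R) setT
        (fun x : R => Rint_n (fun y : 'rV[R]_n' => f (row_mx (const_mx x : 'rV[R]_1) y)))
  end.

(* integral over R^(k d), points z = (s_1,...,s_k) written as k x d matrices
   whose i-th row is s_i *)
Definition Rint_mx (k d : nat) (f : 'M[R]_(k, d) -> R) : R :=
  Rint_n (fun v : 'rV[R]_(k * d) => f (vec_mx v)).

Definition inD (k d p : nat) (c0 : 'I_p -> R) (c : 'I_p -> 'I_k -> R)
  (s : 'rV[R]_d) (z : 'M[R]_(k, d)) : bool :=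
  [exists j : 'I_p, c0 j *: s + \sum_(i < k) c j i *: row i z == 0].

Definition latpt (k d N : nat) (L : R) (a : 'M['I_(2 * N + 1)]_(k, d))
  : 'M[R]_(k, d) :=
  \matrix_(i, j) (((nat_of_ord (a i j))%:R - N%:R) / L).

Definition latsum_N (k d p : nat) (c0 : 'I_p -> R) (c : 'I_p -> 'I_k -> R)
  (s : 'rV[R]_d) (L : R) (g : 'M[R]_(k, d) -> R) (N : nat) : R :=
  \sum_(a : 'M['I_(2 * N + 1)]_(k, d) | ~~ inD c0 c s (latpt L a)) g (latpt L a).

(* the (absolutely convergent) lattice sum over (Z^d_L)^k \ D_s *)
Definition latsum (k d p : nat) (c0 : 'I_p -> R) (c : 'I_p -> 'I_k -> R)
  (s : 'rV[R]_d) (L : R) (g : 'M[R]_(k, d) -> R) : R :=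
  limn (latsum_N c0 c s L g).

(* tuples -> matrices, to express Borel measurability on R^(kd) x R^m x R *)
Definition mx_of_tuple (p q : nat) (t : (p * q).-tuple R) : 'M[R]_(p, q) :=
  \matrix_(i, j) tnth t (mxvec_index i j).
Definition row_of_tuple (n : nat) (t : n.-tuple R) : 'rV[R]_n :=
  \row_j tnth t j.

Definition nuI : set R := `]0, 2^-1]%classic.

Definition meas3 (k d m : nat) (g : 'M[R]_(k, d) -> 'rV[R]_m -> R -> R) : Prop :=
  measurable_fun
    [set x : ((k * d).-tuple R * m.-tuple R) * R | nuI x.2]
    (fun x => g (mx_of_tuple x.1.1) (row_of_tuple x.1.2) x.2).

Definition S_s (k d m p : nat) (c0 : 'I_p -> R) (c : 'I_p -> 'I_k -> R)
  (G : 'rV[R]_d -> 'M[R]_(k, d) -> 'rV[R]_m -> R -> R)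
  (s : 'rV[R]_d) (nu L : R) : R :=
  Rint_n (fun th : 'rV[R]_m =>
    L ^- (k * d) * latsum c0 c s L (fun z => G s z th nu)).

Definition J_s (k d m : nat)
  (G : 'rV[R]_d -> 'M[R]_(k, d) -> 'rV[R]_m -> R -> R)
  (s : 'rV[R]_d) (nu : R) : R :=
  Rint_n (fun th : 'rV[R]_m => Rint_mx (fun z => G s z th nu)).

End Defs.

(* Main.v *)
(** For a fixed theta the lattice sum is a midpoint rule on cells of side 1/L.  In
    one variable the error on a cell is of the order L^-3 sup |f''|, because the
    linear Taylor term integrates to zero; in several variables one sums over one
    coordinate at a time, comparing first the sum with the integral in that
    coordinate and then applying the lower-dimensional estimate under the
    integral sign, so that only the pure second derivatives enter and the total
    error is O(nu^-2 L^-2).  The sums run over a finite box, the mass outside of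
    which vanishes in the limit.  A hyperplane of D_s contains at most one lattice
    point for every choice of k - 1 of the rows, so the excluded points contribute
    O(L^-d), which is O(L^-2) as d >= 2.  Integrating over theta preserves the
    estimate. *)

Require Import Defs.
From HB Require Import structures.
From mathcomp Require Import all_boot all_order all_algebra.
From mathcomp Require Import all_classical all_reals all_analysis.
From mathcomp Require Import measurable_realfun ring lra.
Import Order.TTheory GRing.Theory Num.Theory.
Import numFieldNormedType.Exports.
Local Open Scope classical_set_scope.
Local Open Scope ring_scope.

(** * The weight [wt] on the line and its integrals *)

Section one_dimension.
Set Implicit Arguments. Unset Strict Implicit.
Context {R : realType}.
Notation mu := (@lebesgue_measure R).

(* Every Schwartz-type majorant [C^#] is bounded by a product of such weights,
   whose primitive [atan] turns all sums over grid cells into telescoping ones. *)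
Definition wt (x : R) : R := (1 + x ^+ 2)^-1.

Lemma wt_den_gt0 (x : R) : 0 < 1 + x ^+ 2.
Proof. by rewrite ltr_pwDl ?sqr_ge0. Qed.

Lemma wt_gt0 (x : R) : 0 < wt x.
Proof. by rewrite invr_gt0 wt_den_gt0. Qed.

Lemma wt_ge0 (x : R) : 0 <= wt x. Proof. exact: ltW (wt_gt0 x). Qed.

Lemma continuous_wt : continuous wt.
Proof. exact: continuous_oneDsqrV. Qed.

(** With e = x - y, the inequality (x + e)^2 >= 0 gives y^2 <= 2 x^2 + 2 e^2, and 2 e^2 <= 1/2. *)
Lemma wt_shift (x y : R) : `|x - y| <= 2^-1 -> wt x <= 2 * wt y.
Proof.
rewrite ler_norml => /andP[h1 h2].
have -> : 2 * wt y = (2^-1 * (1 + y ^+ 2))^-1 by rewrite invfM invrK.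
rewrite lef_pV2 ?posrE ?wt_den_gt0//; last by rewrite mulr_gt0 ?wt_den_gt0.
have := sqr_ge0 (x + (x - y)); nra.
Qed.

Lemma atan_increment (a b : R) : a < b ->
  exists2 c, c \in `]a, b[%R & atan b - atan a = wt c * (b - a).
Proof.
move=> ab; apply: (MVT ab).
apply: continuous_in_subspaceT => z _; exact: continuous_atan.
Qed.

(** The increment of [atan] is [h * wt c] for some c in the cell; h <= 1 puts c within 1/2 of x,
    where [wt_shift] applies. *)
Lemma wt_le_atan (h x : R) : 0 < h -> h <= 1 ->
  h * wt x <= 2 * (atan (x + h / 2) - atan (x - h / 2)).
Proof.
move=> h0 h1.
have [|c] := @atan_increment (x - h / 2) (x + h / 2); first lra.
rewrite in_itv/= => /andP[c1 c2] ->.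
have : wt x <= 2 * wt c by apply: wt_shift; rewrite ler_norml; apply/andP; split; lra.
have -> : x + h / 2 - (x - h / 2) = h by lra.
nra.
Qed.

Lemma integral_wt_cy (a : R) :
  (\int[mu]_(x in `[a, +oo[) (wt x)%:E = (pi / 2 - atan a)%:E)%E.
Proof.
rewrite (@ge0_continuous_FTC2y R wt atan a (pi / 2)) ?EFinB//.
- by move=> x _; exact: wt_ge0.
- apply/continuous_within_itvcyP; split; first by move=> x x0; exact: continuous_wt.
  by apply: cvg_at_right_filter; exact: continuous_wt.
- exact: cvgy_atan.
- by apply: cvg_at_right_filter; exact: continuous_atan.
- by move=> x _; rewrite derive1E; exact: derive_val.
Qed.

Lemma measurable_wt (D : set R) : measurable_fun D wt.
Proof.
apply: measurable_funTS.
exact: (continuous_measurable_fun continuous_wt).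
Qed.

Lemma integral_wt : (\int[mu]_x (wt x)%:E = pi%:E)%E.
Proof.
rewrite ge0_symfun_integralT; first last.
- by move=> x; rewrite /= /wt sqrrN.
- exact: continuous_wt.
- exact: wt_ge0.
rewrite -set_itvcy integral_wt_cy atan0 subr0 -EFinM; congr EFin; lra.
Qed.

Lemma integrable_wt1 (D : set R) : measurable D -> mu.-integrable D (EFin \o wt).
Proof.
move=> mD; apply: (@integrableS _ _ _ _ setT) => //.
apply/integrableP; split.
  by apply/measurable_EFinP; exact: measurable_wt.
under eq_integral do rewrite /= ger0_norm ?wt_ge0//.
by rewrite integral_wt ltry.
Qed.

Lemma integrable_wt (A : R) (D : set R) : measurable D ->
  mu.-integrable D (fun x => (A * wt x)%:E).
Proof.
move=> mD; rewrite (_ : (fun x => _) = (fun x => A%:E * (wt x)%:E)%E); last first.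
  by apply/funext => x; rewrite EFinM.
by apply: integrableZl => //; exact: integrable_wt1.
Qed.

Lemma Rintegral_wt (A : R) : Rintegral mu setT (fun x => A * wt x) = A * pi.
Proof.
rewrite RintegralZl//; last exact: integrable_wt1.
by rewrite /Rintegral integral_wt.
Qed.

Lemma integrable_dom (f : R -> R) (A : R) (D : set R) : measurable D ->
  measurable_fun setT f -> (forall x, `|f x| <= A * wt x) ->
  mu.-integrable D (EFin \o f).
Proof.
move=> mD mf fA.
apply: (le_integrable _ _ _ (@integrable_wt A D mD)) => //.
  by apply/measurable_EFinP; exact: measurable_funTS.
by move=> x _; rewrite /= lee_fin (le_trans (fA x))// ler_norm.
Qed.

(** The factor pi is the total mass of [wt]. *)
Lemma le_Rintegral_dom (f : R -> R) (A : R) :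
  measurable_fun setT f -> (forall x, `|f x| <= A * wt x) ->
  `|Rintegral mu setT f| <= A * pi.
Proof.
move=> mf fA; have fi := integrable_dom measurableT mf fA.
rewrite -Rintegral_wt; apply: (le_trans (le_normr_Rintegral _ fi)) => //.
apply: le_Rintegral => //; last exact: integrable_wt.
apply: (@integrable_dom _ A) => //; first exact: measurableT_comp.
by move=> x; rewrite normr_id.
Qed.

Lemma Rintegral_wt_oy (A a : R) :
  Rintegral mu `]a, +oo[ (fun x => A * wt x) = A * (pi / 2 - atan a).
Proof.
rewrite RintegralZl//; last exact: integrable_wt1.
rewrite /Rintegral integral_itv_obnd_cbnd ?integral_wt_cy//.
by apply/measurable_EFinP; exact: measurable_wt.
Qed.


Lemma Rintegral_wt_Nyc (A a : R) :
  Rintegral mu `]-oo, a] (fun x => A * wt x) = A * (atan a + pi / 2).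
Proof.
have := @Rintegral_itvB _ (fun x => A * wt x) -oo%O +oo%O a.
rewrite set_itvNyy => /(_ (integrable_wt _ measurableT)).
rewrite Rintegral_wt Rintegral_wt_oy => /(_ erefl erefl) H.
lra.
Qed.

End one_dimension.

(** * The midpoint rule in one variable *)

Section midpoint_rule.
Set Implicit Arguments. Unset Strict Implicit.
Context {R : realType}.
Notation mu := (@lebesgue_measure R).

Lemma is_derive_shift (F : R -> R) (x t D : R) :
  is_derive (x + t) 1 F D -> is_derive t 1 (fun u => F (x + u)) D.
Proof.
move=> HF; have H : is_derive t 1 (fun u : R => x + u) (1:R).
  by have := is_deriveD (is_derive_cst x t 1) (is_derive_id t (1:R)); rewrite add0r.
by rewrite -[D]mulr1; exact: (is_derive1_comp (g := fun u => x + u)).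
Qed.

Lemma is_derive_reflect (F : R -> R) (x t D : R) :
  is_derive (x - t) 1 F D -> is_derive t 1 (fun u => F (x - u)) (- D).
Proof.
move=> HF; have H : is_derive t 1 (fun u : R => x - u) (-1:R).
  by have := is_deriveB (is_derive_cst x t 1) (is_derive_id t (1:R)); rewrite add0r.
by rewrite -mulrN1; exact: (is_derive1_comp (g := fun u => x - u)).
Qed.

Lemma is_derive_continuous (F : R -> R) (x D : R) :
  is_derive x 1 F D -> {for x, continuous F}.
Proof. by move=> [dF _]; apply: differentiable_continuous; exact/derivable1_diffP. Qed.

Lemma mean_value_bound (F f : R -> R) (a b S : R) : a <= b ->
  (forall x : R, is_derive x 1 F (f x)) ->
  (forall x, a <= x <= b -> `|f x| <= S) -> `|F b - F a| <= S * (b - a).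
Proof.
move=> ab dF fS; have [|c cab ->] := @MVT_segment R F f a b ab.
  by apply: continuous_in_subspaceT => x _; exact: is_derive_continuous (dF x).
rewrite normrM (@ger0_norm _ (b - a)) ?subr_ge0// ler_wpM2r ?subr_ge0//.
by apply: fS; move: cab; rewrite in_itv.
Qed.

(* Mean value theorem on [t |-> F (x0 + t) - F (x0 - t) - 2 * f x0 * t], on its
   derivative, and on [g1]. *)
Lemma midpoint_cell (F f g1 g2 : R -> R) (x0 h B : R) : 0 < h -> h <= 1 ->
  (forall x : R, is_derive x 1 F (f x)) -> (forall x : R, is_derive x 1 f (g1 x)) ->
  (forall x : R, is_derive x 1 g1 (g2 x)) -> (forall x, `|g2 x| <= B * wt x) ->
  `|h * f x0 - (F (x0 + h / 2) - F (x0 - h / 2))| <=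
  B * h ^+ 2 * (atan (x0 + h / 2) - atan (x0 - h / 2)).
Proof.
move=> h0 h1 dF df dg1 g2B.
have B0 : 0 <= B.
  by rewrite -(pmulr_lge0 _ (wt_gt0 x0)); apply: le_trans (g2B x0).
(* The cell has half-width at most 1/2, so [wt] is at most [2 * wt x0] on it and [S] bounds [g2] on
   the whole cell. *)
pose S := B * (2 * wt x0).
have S0 : 0 <= S by rewrite !mulr_ge0 ?wt_ge0.
have g2S x : x0 - h / 2 <= x <= x0 + h / 2 -> `|g2 x| <= S.
  move=> /andP[x1 x2]; apply: (le_trans (g2B x)); apply: ler_wpM2l => //.
  by apply: wt_shift; rewrite ler_norml; apply/andP; split; lra.
have b1 t : 0 <= t <= h / 2 -> `|g1 (x0 + t) - g1 (x0 - t)| <= 2 * S * (h / 2).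
  move=> /andP[t0 t1]; apply: (@le_trans _ _ (S * ((x0 + t) - (x0 - t)))).
    apply: (mean_value_bound _ dg1); first lra.
    by move=> x /andP[x1 x2]; apply: g2S; apply/andP; split; lra.
  by have := ler_wpM2l S0 t1; lra.
pose psi t := f (x0 + t) + f (x0 - t) - 2 * f x0.
have b2 t : 0 <= t <= h / 2 -> `|psi t| <= 2 * S * (h / 2) * (h / 2).
  move=> /andP[t0 t1].
  have -> : psi t = psi t - psi 0 by rewrite /psi addr0 subr0; ring.
  apply: (@le_trans _ _ (2 * S * (h / 2) * (t - 0))); last first.
    by rewrite subr0 ler_wpM2l//; apply: mulr_ge0; [apply: mulr_ge0 => //|]; lra.
  apply: (@mean_value_bound _ (fun t => g1 (x0 + t) - g1 (x0 - t))) => //.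
    move=> x; rewrite -[g1 _ - _]subr0.
    exact: (is_deriveB (is_deriveD (is_derive_shift (df _)) (is_derive_reflect (df _)))
      (is_derive_cst (2 * f x0) x 1)).
  by move=> x /andP[x1 x2]; apply: b1; apply/andP; split; lra.
pose phi t := F (x0 + t) - F (x0 - t) - 2 * f x0 * t.
have -> : h * f x0 - (F (x0 + h / 2) - F (x0 - h / 2)) = - (phi (h / 2) - phi 0).
  by rewrite /phi addr0 subr0; field.
rewrite normrN; apply: (@le_trans _ _ (2 * S * (h / 2) * (h / 2) * (h / 2 - 0))).
  apply: (mean_value_bound _ _ b2); first lra.
  move=> x; rewrite /psi -[f (x0 - x)]opprK -[2 * f x0]mulr1.
  exact: (is_deriveB (is_deriveB (is_derive_shift (dF _)) (is_derive_reflect (dF _)))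
    (is_deriveZ (2 * f x0) (is_derive_id x (1:R)))).
have := wt_le_atan x0 h0 h1.
set dat := atan _ - atan _ => H.
(* Of the three factors h, one is kept with [wt x0] and traded for the increment of [atan], which
   telescopes over the cells. *)
have -> : 2 * S * (h / 2) * (h / 2) * (h / 2 - 0) = B * h ^+ 2 * (h * wt x0 / 2).
  by rewrite /S; field.
by rewrite ler_wpM2l ?mulr_ge0 ?sqr_ge0//; lra.
Qed.

(** Adjacent cells share an endpoint: [u a] is the value of F at the left end of cell a, [u a.+1] at
    its right end. *)
Lemma telescope_grid (F : R -> R) (h : R) (N : nat) :
  \sum_(a < 2 * N + 1) (F ((a%:R - N%:R) * h + h / 2) - F ((a%:R - N%:R) * h - h / 2))
  = F ((N%:R + 2^-1) * h) - F (- ((N%:R + 2^-1) * h)).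
Proof.
pose u (a : nat) := F ((a%:R - N%:R - 2^-1) * h).
rewrite (eq_bigr (fun a : 'I_(2 * N + 1) => u a.+1 - u a)); last first.
  by move=> a _; congr (F _ - F _); rewrite -?[a.+1]addn1 ?natrD; field.
rewrite -(big_mkord xpredT (fun a => u a.+1 - u a)) telescope_sumr//.
by rewrite /u natrD natrM; congr (F _ - F _); field.
Qed.

(* The mass of [wt] outside the union of the cells of the grid. *)
Definition tail (h : R) (N : nat) : R := pi - 2 * atan ((N%:R + 2^-1) * h).

Lemma tail_ge0 (h : R) (N : nat) : 0 <= tail h N.
Proof. have := atan_ltpi2 ((N%:R + 2^-1) * h); rewrite /tail; lra. Qed.

Lemma cvg_tail (h : R) : 0 < h -> tail h @ \oo --> (0 : R).
Proof.
move=> h0; have -> : (0 : R) = pi - 2 * (pi / 2) by field.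
apply: cvgB; first exact: cvg_cst.
apply: cvgM; first exact: cvg_cst.
apply: (@cvg_comp _ _ _ (fun N : nat => (N%:R + 2^-1) * h) atan); last exact: cvgy_atan.
apply/cvgryPge => A; near=> n; rewrite -ler_pdivrMr//.
apply: (@le_trans _ _ n%:R); last by rewrite lerDl invr_ge0.
by near: n; exact: nbhs_infty_ger.
Unshelve. all: by end_near.
Qed.

(** The cell errors sum to at most [B * h ^+ 2 * (2 * atan M)], where [-M, M] is the union of the
    cells; the mass of f outside [-M, M] is at most [A * tail h N]. *)
Lemma grid_sum_integral (f g1 g2 : R -> R) (h A B : R) (N : nat) :
  0 < h -> h <= 1 -> measurable_fun setT f ->
  (forall x : R, is_derive x 1 f (g1 x)) -> (forall x : R, is_derive x 1 g1 (g2 x)) ->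
  (forall x, `|f x| <= A * wt x) -> (forall x, `|g2 x| <= B * wt x) ->
  `|h * \sum_(a < 2 * N + 1) f ((a%:R - N%:R) * h) - Rintegral mu setT f| <=
  pi * (B * h ^+ 2 + A * tail h N).
Proof.
move=> h0 h1 mf df dg1 fA g2B.
have A0 : 0 <= A by rewrite -(pmulr_lge0 _ (wt_gt0 0)); apply: le_trans (fA 0).
have B0 : 0 <= B by rewrite -(pmulr_lge0 _ (wt_gt0 0)); apply: le_trans (g2B 0).
pose F x := Rintegral mu `]-oo, x] f.
have intf (D : set R) : measurable D -> mu.-integrable D (EFin \o f).
  by move=> mD; exact: integrable_dom fA.
have dF (x : R) : is_derive x 1 F (f x).
  (* The fundamental theorem is applied below some right endpoint beyond x; x + 1 is an arbitrary
     choice. *)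
  have xx1 : x < x + 1 by lra.
  have [dFx F'x] := @continuous_FTC1 R f -oo%O x (x + 1) xx1
    (intf _ (measurable_itv _)) (ltNyr _) (is_derive_continuous (df x)).
  by rewrite -F'x derive1E; exact: DeriveDef.
have normF (D : set R) : measurable D -> `|Rintegral mu D f| <= Rintegral mu D (fun x => A * wt x).
  move=> mD; apply: (le_trans (le_normr_Rintegral _ (intf D mD))) => //.
  apply: le_Rintegral => //; last exact: integrable_wt.
  apply: (@integrable_dom _ _ A) => //; first exact: measurableT_comp.
  by move=> x; rewrite normr_id.
pose M := (N%:R + 2^-1) * h.
have I1 : `|\sum_(a < 2 * N + 1) (h * f ((a%:R - N%:R) * h) -
    (F ((a%:R - N%:R) * h + h / 2) - F ((a%:R - N%:R) * h - h / 2)))| <=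
    B * h ^+ 2 * (2 * atan M).
  apply: (le_trans (ler_norm_sum _ _ _)).
  have -> : 2 * atan M = atan M - atan (- M) by rewrite atanN; ring.
  rewrite -telescope_grid mulr_sumr; apply: ler_sum => a _.
  exact: (@midpoint_cell F f g1 g2).
rewrite sumrB telescope_grid -mulr_sumr in I1.
have I2 : `|Rintegral mu setT f - F M| <= A * (pi / 2 - atan M).
  have := @Rintegral_itvB _ f -oo%O +oo%O M; rewrite set_itvNyy => /(_ (intf _ measurableT)).
  rewrite /F => -> //; rewrite -Rintegral_wt_oy; exact: normF.
have I3 : `|F (- M)| <= A * (pi / 2 - atan M).
  apply: (le_trans (normF _ _)) => //.
  by rewrite Rintegral_wt_Nyc atanN addrC.
have aM : 2 * atan M <= pi by have := atan_ltpi2 M; lra.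
have p2 : 2 <= pi :> R by exact: pi_ge2.
(* Both errors are enlarged to carry the common factor pi: 2 atan M <= pi for the first, 1 <= pi for
   the second. *)
have I4 : B * h ^+ 2 * (2 * atan M) <= pi * (B * h ^+ 2).
  by rewrite mulrC ler_wpM2r// mulr_ge0// sqr_ge0.
have I5 : A * tail h N <= pi * (A * tail h N).
  by rewrite ler_peMl ?mulr_ge0 ?tail_ge0//; lra.
have -> : pi * (B * h ^+ 2 + A * tail h N) = pi * (B * h ^+ 2) + pi * (A * tail h N) by ring.
move: I1 I2 I3 I4 I5; rewrite !ler_norml /tail -/M.
set sm := h * _; set J := Rintegral _ _ _.
move=> /andP[? ?] /andP[? ?] /andP[? ?] ? ?; apply/andP; split; lra.
Qed.

(** Each term is at most twice the increment of [atan] over its cell, and the total increment is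
    below pi, whatever h and N. *)
Lemma grid_sum_wt (h : R) (N : nat) : 0 < h -> h <= 1 ->
  h * \sum_(a < 2 * N + 1) wt ((a%:R - N%:R) * h) <= 2 * pi.
Proof.
move=> h0 h1; rewrite mulr_sumr.
apply: (@le_trans _ _ (2 * \sum_(a < 2 * N + 1)
  (atan ((a%:R - N%:R) * h + h / 2) - atan ((a%:R - N%:R) * h - h / 2)))).
  by rewrite mulr_sumr; apply: ler_sum => a _; exact: wt_le_atan.
rewrite telescope_grid atanN opprK.
have := atan_ltpi2 ((N%:R + 2^-1) * h); lra.
Qed.

End midpoint_rule.

(** * Measurability, bounds and linearity of the iterated integral *)

Section iterated_integral.
Set Implicit Arguments. Unset Strict Implicit.
Context {R : realType}.
Notation mu := (@lebesgue_measure R).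

(** Tonelli gives measurability for the positive and negative parts; the integral is the finite part
    of their difference. *)
Lemma measurable_Rintegral_param d (T : measurableType d) (g : T * R -> R) :
  measurable_fun setT g ->
  measurable_fun setT (fun t => Rintegral mu setT (fun x => g (t, x))).
Proof.
move=> mg; have mEg : measurable_fun setT (EFin \o g) by exact/measurable_EFinP.
apply: (@measurableT_comp _ _ _ _ _ _ (@fine R)); first exact: fine_measurable.
under eq_fun do rewrite integralE.
have mp := measurable_fun_fubini_tonelli_F (m2 := mu) _ (measurable_funepos mEg)
  (funepos_ge0 (EFin \o g)).
have mn := measurable_fun_fubini_tonelli_F (m2 := mu) _ (measurable_funeneg mEg)
  (funeneg_ge0 (EFin \o g)).
apply: eq_measurable_fun (emeasurable_funB mp mn) => t _.
by rewrite /= /fubini_F; congr (_ - _)%E; apply: eq_integral => x _;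
  rewrite ?funeposE ?funenegE.
Qed.

(** Joint measurability is read through tuples, which carry the product sigma-algebra; T is a space
    of parameters. *)
Definition measurable_rows d (T : measurableType d) n (F : T -> 'rV[R]_n -> R) :=
  measurable_fun setT (fun x : T * n.-tuple R => F x.1 (row_of_tuple x.2)).

Definition measurable_row n (f : 'rV[R]_n -> R) :=
  measurable_fun setT (fun x : n.-tuple R => f (row_of_tuple x)).

(** This is the row built in the recursive clause of [Rint_n], so the two agree by conversion. *)
Definition cons_row n (x : R) (v : 'rV[R]_n) : 'rV[R]_n.+1 :=
  row_mx (const_mx x : 'rV[R]_1) v.

Lemma cons_row0 n x (v : 'rV[R]_n) : cons_row x v 0 ord0 = x.
Proof.
apply: etrans (etrans (row_mxEl (const_mx x : 'rV[R]_1) v 0 ord0) (mxE _ _ _ _)).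
by congr (row_mx _ _ _ _); apply/val_inj.
Qed.

Lemma cons_rowS n x (v : 'rV[R]_n) j : cons_row x v 0 (lift ord0 j) = v 0 j.
Proof.
rewrite -[RHS](row_mxEr (const_mx x : 'rV[R]_1) v 0 j) /cons_row.
by congr (row_mx _ _ _ _); apply/val_inj.
Qed.

Lemma row_of_tuple_cons n x (t : n.-tuple R) :
  row_of_tuple [the n.+1.-tuple R of x :: t] = cons_row x (row_of_tuple t).
Proof.
apply/rowP => j; case: (unliftP ord0 j) => [i|] ->.
  by rewrite cons_rowS !mxE tnthS.
by rewrite cons_row0 mxE tnth0.
Qed.

Lemma row_of_tuple_surj n (v : 'rV[R]_n) : exists t, row_of_tuple t = v.
Proof.
by exists [tuple v 0 j | j < n]; apply/rowP => j; rewrite mxE tnth_mktuple.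
Qed.

Lemma measurable_rows_slice d (T : measurableType d) n (F : T -> 'rV[R]_n -> R) t :
  measurable_rows F -> measurable_row (F t).
Proof.
move=> mF; exact: (measurableT_comp mF (measurable_fun_pair (measurable_cst t) (@measurable_id _ _ setT))).
Qed.

Lemma measurable_rows_cons d (T : measurableType d) n (F : T -> 'rV[R]_n.+1 -> R) :
  measurable_rows F ->
  measurable_rows (fun (tx : T * R) v => F tx.1 (cons_row tx.2 v)).
Proof.
move=> mF; rewrite /measurable_rows.
under eq_fun do rewrite -row_of_tuple_cons.
have mg : measurable_fun setT (fun x : (T * R) * n.-tuple R =>
    (x.1.1, [the n.+1.-tuple R of x.1.2 :: x.2])).
  apply: measurable_fun_pair; first exact: measurableT_comp.
  by apply: measurable_cons => //; exact: measurableT_comp.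
exact: (measurableT_comp mF mg).
Qed.

Lemma measurable_row_cons n (f : 'rV[R]_n.+1 -> R) :
  measurable_row f -> measurable_rows (fun x v => f (cons_row x v)).
Proof.
move=> mf; rewrite /measurable_rows.
under eq_fun do rewrite -row_of_tuple_cons.
have mg : measurable_fun setT (fun x : R * n.-tuple R =>
    [the n.+1.-tuple R of x.1 :: x.2]) by exact: measurable_cons.
exact: (measurableT_comp mf mg).
Qed.

(** The induction varies T: the outermost variable joins the parameters, the inner integral is
    jointly measurable by induction, and one parametrised integral remains. *)
Lemma measurable_Rint_n d (T : measurableType d) n (F : T -> 'rV[R]_n -> R) :
  measurable_rows F -> measurable_fun setT (fun t => Rint_n (F t)).
Proof.
elim: n d T F => [|n IHn] d T F mF /=.
  have -> : (fun t => F t 0) = (fun t => F t (row_of_tuple [tuple])).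
    by apply/funext => t; rewrite [row_of_tuple _]thinmx0.
  exact: (measurableT_comp mF (measurable_fun_pair (@measurable_id _ _ setT) (measurable_cst [tuple]))).
exact: (measurable_Rintegral_param (IHn _ _ _ (measurable_rows_cons mF))).
Qed.

(** The product form lets the weight split off one variable at a time in iterated sums and
    integrals. *)
Definition rwt n (v : 'rV[R]_n) : R := \prod_(j < n) wt (v 0 j).

Lemma rwt_gt0 n (v : 'rV[R]_n) : 0 < rwt v.
Proof. by apply: prodr_gt0 => j _; exact: wt_gt0. Qed.

Lemma rwt_ge0 n (v : 'rV[R]_n) : 0 <= rwt v. Proof. exact: ltW (rwt_gt0 v). Qed.

Lemma rwt_cons n x (v : 'rV[R]_n) : rwt (cons_row x v) = wt x * rwt v.
Proof.
rewrite /rwt big_ord_recl cons_row0; congr (_ * _).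
by apply: eq_bigr => j _; rewrite cons_rowS.
Qed.

(** Each integration consumes one factor [wt] and yields one factor pi. *)
Lemma Rint_n_bound n (f : 'rV[R]_n -> R) (E : R) : measurable_row f ->
  (forall v, `|f v| <= E * rwt v) -> `|Rint_n f| <= E * pi ^+ n.
Proof.
elim: n f E => [|n IHn] f E mf fE /=.
  by rewrite expr0; have := fE 0; rewrite /rwt big_ord0.
rewrite exprSr mulrA; apply: le_Rintegral_dom.
  exact: measurable_Rint_n (measurable_row_cons mf).
move=> x; rewrite mulrAC; apply: IHn.
  exact: measurable_rows_slice (measurable_row_cons mf).
by move=> v; rewrite -mulrA -rwt_cons; exact: fE.
Qed.

Lemma integrable_Rint_n n (f : 'rV[R]_n.+1 -> R) (E : R) : measurable_row f ->
  (forall v, `|f v| <= E * rwt v) ->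
  mu.-integrable setT (EFin \o (fun x => Rint_n (fun v => f (cons_row x v)))).
Proof.
move=> mf fE; apply: (@integrable_dom _ _ (E * pi ^+ n)) => //.
  exact: measurable_Rint_n (measurable_row_cons mf).
move=> x; rewrite mulrAC; apply: Rint_n_bound.
  exact: measurable_rows_slice (measurable_row_cons mf).
by move=> v; rewrite -mulrA -rwt_cons; exact: fE.
Qed.

(** Domination by [rwt] makes the integrand integrable at every level of the iteration, where
    linearity is then available. *)
Lemma Rint_nB n (f g : 'rV[R]_n -> R) (E E' : R) :
  measurable_row f -> measurable_row g ->
  (forall v, `|f v| <= E * rwt v) -> (forall v, `|g v| <= E' * rwt v) ->
  Rint_n (fun v => f v - g v) = Rint_n f - Rint_n g.
Proof.
elim: n f g E E' => [//|n IHn] f g E E' mf mg fE gE /=.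
rewrite -RintegralB//; first last.
- exact: integrable_Rint_n gE.
- exact: integrable_Rint_n fE.
apply: eq_Rintegral => x _; apply: (IHn _ _ (E * wt x) (E' * wt x)).
- exact: measurable_rows_slice (measurable_row_cons mf).
- exact: measurable_rows_slice (measurable_row_cons mg).
- by move=> v; rewrite -mulrA -rwt_cons; exact: fE.
- by move=> v; rewrite -mulrA -rwt_cons; exact: gE.
Qed.

End iterated_integral.

(** * The midpoint rule in several variables *)

Section grid.
Set Implicit Arguments. Unset Strict Implicit.
Context {R : realType}.
Notation mu := (@lebesgue_measure R).

Lemma Rintegral_sum (I : Type) (r : seq I) (F : I -> R -> R) :
  (forall i, mu.-integrable setT (EFin \o F i)) ->
  Rintegral mu setT (fun x => \sum_(i <- r) F i x) =
  \sum_(i <- r) Rintegral mu setT (F i).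
Proof.
move=> iF; elim: r => [|i r IHr].
  rewrite big_nil; under eq_Rintegral do rewrite big_nil.
  by rewrite Rintegral_cst// mul0r.
rewrite big_cons -IHr -RintegralD//.
  by apply: eq_Rintegral => x _; rewrite big_cons.
rewrite (_ : _ \o _ = fun x => (\sum_(j <- r) (F j x)%:E)%E).
  by apply: integrable_sum => // j _; exact: iF.
by apply/funext => x; rewrite /= sumEFin.
Qed.

Definition gridrow (h : R) (N n : nat) (a : 'rV['I_(2 * N + 1)]_n) : 'rV[R]_n :=
  \row_j (((a 0 j : nat)%:R - N%:R) * h).

Definition consI (M n : nat) (x : 'I_M) (b : 'rV['I_M]_n) : 'rV['I_M]_n.+1 :=
  row_mx (const_mx x : 'rV['I_M]_1) b.

Lemma consI0 M n x (v : 'rV['I_M]_n) : consI x v 0 ord0 = x.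
Proof.
apply: etrans (etrans (row_mxEl (const_mx x : 'rV['I_M]_1) v 0 ord0) (mxE _ _ _ _)).
by congr (row_mx _ _ _ _); apply/val_inj.
Qed.

Lemma consIS M n x (v : 'rV['I_M]_n) j : consI x v 0 (lift ord0 j) = v 0 j.
Proof.
rewrite -[RHS](row_mxEr (const_mx x : 'rV['I_M]_1) v 0 j) /consI.
by congr (row_mx _ _ _ _); apply/val_inj.
Qed.

Lemma sum_consI M n (F : 'rV['I_M]_n.+1 -> R) :
  \sum_a F a = \sum_x \sum_b F (consI x b).
Proof.
rewrite pair_big/= (reindex (fun p : 'I_M * 'rV['I_M]_n => consI p.1 p.2))//.
exists (fun a : 'rV['I_M]_n.+1 => (a 0 ord0, \row_j a 0 (lift ord0 j))) => [[x b] _|a _] /=.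
  by rewrite consI0; congr pair; apply/rowP => j; rewrite mxE consIS.
apply/rowP => j; case: (unliftP ord0 j) => [i|] ->; last exact: consI0.
by rewrite consIS mxE.
Qed.

Lemma gridrow_cons h N n x (b : 'rV['I_(2 * N + 1)]_n) :
  gridrow h (consI x b) = cons_row (((x : nat)%:R - N%:R) * h) (gridrow h b).
Proof.
apply/rowP => j; case: (unliftP ord0 j) => [i|] ->.
  by rewrite cons_rowS [LHS]mxE [RHS]mxE consIS.
by rewrite cons_row0 [LHS]mxE consI0.
Qed.

(** The sum factors into n one-dimensional sums, each at most 2 pi by [grid_sum_wt]. *)
Lemma grid_sum_rwt (h : R) (N n : nat) : 0 < h -> h <= 1 ->
  h ^+ n * \sum_(b : 'rV['I_(2 * N + 1)]_n) rwt (gridrow h b) <= (2 * pi) ^+ n.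
Proof.
move=> h0 h1; elim: n => [|n IHn].
  rewrite (eq_bigr (fun=> 1)); last by move=> b _; rewrite /rwt big_ord0.
  by rewrite sumr_const card_mx muln0 expn0 mulr1.
rewrite sum_consI.
have -> : h ^+ n.+1 * (\sum_x \sum_(b : 'rV['I_(2 * N + 1)]_n) rwt (gridrow h (consI x b))) =
  (h * \sum_(x < 2 * N + 1) wt ((x%:R - N%:R) * h)) *
  (h ^+ n * \sum_(b : 'rV['I_(2 * N + 1)]_n) rwt (gridrow h b)).
  rewrite [RHS]mulrACA -exprS; congr (_ * _).
  rewrite mulr_suml; apply: eq_bigr => x _.
  by rewrite mulr_sumr; apply: eq_bigr => b _; rewrite gridrow_cons rwt_cons.
rewrite [leRHS]exprS; apply: ler_pM => //; last exact: grid_sum_wt.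
- by apply: mulr_ge0; [exact: ltW|apply: sumr_ge0 => x _; exact: wt_ge0].
- by apply: mulr_ge0; [exact/exprn_ge0/ltW|apply: sumr_ge0 => b _; exact: rwt_ge0].
Qed.

(** Regularity along coordinate lines only, in the one-variable form that [grid_sum_integral] takes;
    the weighted bound is inherited by slices. *)
Definition C2_along n (B : R) (f : 'rV[R]_n -> R) :=
  forall (v : 'rV[R]_n) (j : 'I_n), exists g1 g2 : R -> R,
    [/\ forall t : R, is_derive t 1 (fun u => f (v + u *: delta_mx 0 j)) (g1 t),
        forall t : R, is_derive t 1 g1 (g2 t)
      & forall t, `|g2 t| <= B * rwt (v + t *: delta_mx 0 j)].

Lemma cons_row_head n x (v : 'rV[R]_n) :
  cons_row 0 v + x *: delta_mx 0 ord0 = cons_row x v.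
Proof.
apply/rowP => j; rewrite [LHS]mxE [X in _ + X]mxE [X in _ * X]mxE.
case: (unliftP ord0 j) => [i|] ->.
  by rewrite !cons_rowS eq_sym (negbTE (neq_lift _ _)) andbF mulr0 addr0.
by rewrite !cons_row0 !eqxx mulr1 add0r.
Qed.

Lemma cons_row_tail n x (v : 'rV[R]_n) t j :
  cons_row x (v + t *: delta_mx 0 j) = cons_row x v + t *: delta_mx 0 (lift ord0 j).
Proof.
apply/rowP => i; rewrite [RHS]mxE [X in _ = _ + X]mxE [X in _ = _ + _ * X]mxE.
case: (unliftP ord0 i) => [k|] ->.
  by rewrite !cons_rowS !mxE (inj_eq lift_inj).
by rewrite !cons_row0 (negbTE (neq_lift _ _)) andbF mulr0 addr0.
Qed.

Lemma C2_along_cons n (B : R) (f : 'rV[R]_n.+1 -> R) x :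
  C2_along B f -> C2_along (B * wt x) (fun v => f (cons_row x v)).
Proof.
move=> Hf v j; have [g1 [g2 [d1 d2 b]]] := Hf (cons_row x v) (lift ord0 j).
exists g1, g2; split => // t.
- by under eq_fun do rewrite cons_row_tail.
- by rewrite -mulrA -rwt_cons cons_row_tail.
Qed.

Lemma measurable_row_head n (f : 'rV[R]_n.+1 -> R) (v : 'rV[R]_n) :
  measurable_row f -> measurable_fun setT (fun x => f (cons_row x v)).
Proof.
move=> /measurable_row_cons mf.
have [t <-] := row_of_tuple_surj v.
exact: (measurableT_comp mf (measurable_fun_pair (@measurable_id _ _ setT)
  (measurable_cst t))).
Qed.

(** Induction through the hybrid quantity [h ^+ n * K], with the first variable integrated and the
    others summed: [T1] compares it with the full sum, [T2] with the full integral. *)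
Lemma grid_Rint_n n (f : 'rV[R]_n -> R) (h A B : R) (N : nat) :
  0 < h -> h <= 1 -> measurable_row f ->
  (forall v, `|f v| <= A * rwt v) -> C2_along B f -> 0 <= B ->
  `|h ^+ n * \sum_(a : 'rV['I_(2 * N + 1)]_n) f (gridrow h a) - Rint_n f| <=
  n%:R * (2 * pi) ^+ n * (B * h ^+ 2 + A * tail h N).
Proof.
move=> h0 h1; elim: n f A B => [|n IHn] f A B mf fA df B0.
  rewrite (eq_bigr (fun=> f 0)); last by move=> b _; rewrite [gridrow _ _]thinmx0.
  by rewrite sumr_const card_mx muln0 expn0 mul1r subrr normr0 !mul0r.
have A0 : 0 <= A by rewrite -(pmulr_lge0 _ (rwt_gt0 (0 : 'rV[R]_n.+1))); apply: le_trans (fA 0).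
have p0 : 0 <= pi :> R := pi_ge0 R.
have hn0 : 0 <= h ^+ n by exact/exprn_ge0/ltW.
set D := B * h ^+ 2 + _; have D0 : 0 <= D.
  by apply: addr_ge0; apply: mulr_ge0; rewrite ?sqr_ge0 ?tail_ge0.
pose G b x := f (cons_row x (gridrow h (b : 'rV['I_(2 * N + 1)]_n))).
have fAx x v : `|f (cons_row x v)| <= A * rwt v * wt x.
  by rewrite -mulrA [rwt v * _]mulrC -rwt_cons; exact: fA.
have iG b : mu.-integrable setT (EFin \o G b).
  apply: (@integrable_dom _ _ (A * rwt (gridrow h b))) => //.
    exact: measurable_row_head.
  by move=> x; exact: fAx.
have iS : mu.-integrable setT (EFin \o (fun x => \sum_b G b x)).
  rewrite (_ : _ \o _ = fun x => (\sum_b (G b x)%:E)%E).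
    by apply: integrable_sum => // i _; exact: iG.
  by apply/funext => x; rewrite /= sumEFin.
pose K := \sum_b Rintegral mu setT (G b).
have T1 : `|h ^+ n.+1 * (\sum_(a : 'rV['I_(2 * N + 1)]_n.+1) f (gridrow h a)) - h ^+ n * K| <=
    pi * D * (2 * pi) ^+ n.
  rewrite exprSr -mulrA -mulrBr normrM (ger0_norm hn0).
  apply: (@le_trans _ _ (pi * D * (h ^+ n *
     \sum_(b : 'rV['I_(2 * N + 1)]_n) rwt (gridrow h b)))); last first.
    by apply: ler_wpM2l; [exact: mulr_ge0|exact: grid_sum_rwt].
  rewrite mulrCA; apply: ler_wpM2l => //.
  (* With b outermost, each term is a one-dimensional grid error in the first variable, with
     constants weighted by [rwt (gridrow h b)]. *)
  rewrite sum_consI exchange_big mulr_sumr -sumrB mulr_sumr.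
  apply: (le_trans (ler_norm_sum _ _ _)); apply: ler_sum => b _.
  have [g1 [g2 [d1 d2 g2B]]] := df (cons_row 0 (gridrow h b)) ord0.
  have -> : pi * D * rwt (gridrow h b) =
    pi * (B * rwt (gridrow h b) * h ^+ 2 + A * rwt (gridrow h b) * tail h N).
    by rewrite /D; ring.
  under eq_bigr do rewrite gridrow_cons.
  apply: (@grid_sum_integral _ (G b) g1 g2) => //.
  - exact: measurable_row_head.
  - move=> t; rewrite (_ : G b = fun u => f (cons_row 0 (gridrow h b) + u *: delta_mx 0 ord0)).
      exact: d1.
    by apply/funext => u; rewrite cons_row_head.
  - by move=> x; exact: fAx.
  - by move=> t; have := g2B t; rewrite cons_row_head rwt_cons [wt t * _]mulrC mulrA.
have T2 : `|h ^+ n * K - Rint_n f| <= n%:R * (2 * pi) ^+ n * D * pi.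
  (* Everything goes under one integral over the first variable, whose integrand is the
     n-dimensional error of a slice. *)
  rewrite /K -Rintegral_sum// -RintegralZl//= -RintegralB//; first last.
  - exact: integrable_Rint_n fA.
  - rewrite (_ : _ \o _ = fun x => ((h ^+ n)%:E * (\sum_b G b x)%:E)%E).
      exact: integrableZl.
    by apply/funext => x; rewrite /= EFinM.
  apply: le_Rintegral_dom.
    apply: measurable_funB; last exact: measurable_Rint_n (measurable_row_cons mf).
    apply: measurable_funM; first exact: measurable_cst.
    by apply: measurable_sum => b; exact: measurable_row_head.
  move=> x; have -> : n%:R * (2 * pi) ^+ n * D * wt x =
    n%:R * (2 * pi) ^+ n * (B * wt x * h ^+ 2 + A * wt x * tail h N).
    by rewrite /D; ring.
  apply: (IHn (fun v => f (cons_row x v)) (A * wt x) (B * wt x)).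
  - exact: measurable_rows_slice (measurable_row_cons mf).
  - by move=> v; rewrite mulrAC.
  - exact: C2_along_cons.
  - by rewrite mulr_ge0 ?wt_ge0.
rewrite -[X in `|X - _|](subrK (h ^+ n * K)) -addrA.
apply: (le_trans (ler_normD _ _)); apply: (le_trans (lerD T1 T2)).
have q0 : 0 <= D * (2 * pi) ^+ n * pi.
  by rewrite !mulr_ge0// exprn_ge0// mulr_ge0.
set q := (2 * pi) ^+ n in q0 *.
(* The two errors add up to exactly half of the claimed bound. *)
have -> : n.+1%:R * (2 * pi) ^+ n.+1 * D = 2 * ((1 + n%:R) * (D * q * pi)).
  by rewrite exprSr -/q -natr1; ring.
have -> : pi * D * q + n%:R * q * D * pi = (1 + n%:R) * (D * q * pi) by ring.
rewrite ler_peMl ?ler1n//; apply: mulr_ge0 => //; exact: addr_ge0.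
Qed.

End grid.

(** * Lattice sums over matrices and the points on one hyperplane *)

Section lattice.
Set Implicit Arguments. Unset Strict Implicit.
Context {R : realType}.

Definition mwt p q (z : 'M[R]_(p, q)) : R := \prod_(i < p) \prod_(j < q) wt (z i j).

Lemma mwt_gt0 p q (z : 'M[R]_(p, q)) : 0 < mwt z.
Proof. by do 2!apply: prodr_gt0 => ? _; exact: wt_gt0. Qed.

Lemma mwt_ge0 p q (z : 'M[R]_(p, q)) : 0 <= mwt z. Proof. exact: ltW (mwt_gt0 z). Qed.

Lemma mwt_vec_mx p q (v : 'rV[R]_(p * q)) : mwt (vec_mx v) = rwt v.
Proof.
rewrite /mwt pair_big /rwt/= (reindex _ (curry_mxvec_bij p q))/=.
by apply: eq_bigr => -[i j] _; rewrite /= mxE.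
Qed.

Lemma mwt_row n (v : 'rV[R]_n) : mwt v = rwt v.
Proof. by rewrite /mwt big_ord1. Qed.

Lemma powE n (y : R) : y ^+ n = \prod_(i < n) y.
Proof. by rewrite prodr_const card_ord. Qed.

(** The square of [jbr x] dominates each of the p q factors 1 + x_ij^2, so its power p q dominates
    the inverse of [mwt x]; hence the decay exponent 2 q p. *)
Lemma Csharp_le_mwt p q (C : 'M[R]_(p, q) -> R) : Csharp C ->
  exists2 M, 0 <= M & forall x, C x <= M * mwt x.
Proof.
move=> [_ [C0 /(_ (2 * (q * p))%N) [M CM]]].
exists `|M| => // x; rewrite -ler_pdivrMr ?mwt_gt0//.
apply: le_trans (ler_norm M); apply: le_trans (CM x).
apply: ler_wpM2l => //; rewrite exprM sqr_sqrtr; last first.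
  by rewrite addr_ge0// !sumr_ge0// => i _; apply: sumr_ge0 => j _; exact: sqr_ge0.
set Q := 1 + _; rewrite exprM (powE p) (powE q) /mwt -prodfV.
have xQ i j : 1 + x i j ^+ 2 <= Q.
  rewrite lerD2l (bigD1 i)//= (bigD1 j)//= -addrA lerDl addr_ge0//.
    by apply: sumr_ge0 => *; exact: sqr_ge0.
  by apply: sumr_ge0 => *; apply: sumr_ge0 => *; exact: sqr_ge0.
apply: ler_prod => i _; rewrite invr_ge0 prodr_ge0//=; last by move=> *; exact: wt_ge0.
rewrite -prodfV; apply: ler_prod => j _.
by rewrite invrK ltW ?wt_den_gt0/=.
Qed.

Lemma sum_mx M k d (F : 'M['I_M]_(k, d) -> R) :
  \sum_a F a = \sum_(v : 'rV['I_M]_(k * d)) F (vec_mx v).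
Proof.
by apply: reindex; exists mxvec => v _; rewrite ?mxvecK ?vec_mxK.
Qed.

Lemma latpt_vec_mx k d N (L : R) (v : 'rV['I_(2 * N + 1)]_(k * d)) :
  latpt L (vec_mx v) = vec_mx (gridrow L^-1 v).
Proof. by apply/matrixP => i j; rewrite !mxE. Qed.

(** The one-variable and the directional difference quotients coincide once their arguments are
    regrouped. *)
Lemma is_derive_line p q (f : 'M[R]_(p, q) -> R) (z E : 'M[R]_(p, q)) (t : R) :
  derivable f (z + t *: E) E ->
  is_derive t 1 (fun u : R => f (z + u *: E)) ('D_E f (z + t *: E)).
Proof.
have e : (fun h : R => h^-1 *: (f (z + (h *: 1 + t) *: E) - f (z + t *: E))) =
   (fun h : R => h^-1 *: (f (h *: E + (z + t *: E)) - f (z + t *: E))).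
  by apply/funext => h; rewrite [h *: 1]mulr1 scalerDl addrCA.
move=> df; apply: DeriveDef; rewrite /derivable /derive /=.
- by rewrite e.
- by rewrite e.
Qed.

Lemma C2_along_vec_mx k d (g : 'M[R]_(k, d) -> R) (B : R) : C2 g ->
  (forall a z, `|pd a (pd a g) z| <= B * mwt z) ->
  C2_along B (fun v => g (vec_mx v)).
Proof.
move=> [_ [d1 [_ [d2 _]]]] gB v l; case: (mxvec_indexP l) => i j.
pose E : 'M[R]_(k, d) := delta_mx i j.
have vE (t : R) : vec_mx (v + t *: delta_mx 0 (mxvec_index i j)) = vec_mx v + t *: E.
  by rewrite linearD linearZ /= vec_mx_delta.
exists (fun t => pd (i, j) g (vec_mx v + t *: E)),
  (fun t => pd (i, j) (pd (i, j) g) (vec_mx v + t *: E)); split => t.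
- under eq_fun do rewrite vE.
  apply: is_derive_line; exact: (d1 (i, j)).
- apply: is_derive_line; exact: (d2 (i, j) (i, j)).
- by rewrite -mwt_vec_mx vE; exact: gB.
Qed.

Lemma lattice_sum_Rint_mx k d (g : 'M[R]_(k, d) -> R) (L A B : R) (N : nat) :
  1 <= L -> measurable_row (fun v => g (vec_mx v)) ->
  (forall z, `|g z| <= A * mwt z) -> C2 g ->
  (forall a z, `|pd a (pd a g) z| <= B * mwt z) -> 0 <= B ->
  `|L ^- (k * d) * \sum_(a : 'M['I_(2 * N + 1)]_(k, d)) g (latpt L a) - Rint_mx g| <=
  (k * d)%:R * (2 * pi) ^+ (k * d) * (B * L ^- 2 + A * tail L^-1 N).
Proof.
move=> L1 mg gA gC2 gB B0; have L0 : 0 < L by exact: lt_le_trans L1.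
rewrite -!exprVn sum_mx; under eq_bigr do rewrite latpt_vec_mx.
apply: grid_Rint_n => //; rewrite ?invr_gt0 ?invf_le1//.
- by move=> v; rewrite -mwt_vec_mx.
- exact: C2_along_vec_mx.
Qed.

Lemma sum_mwt_le k d (L : R) (N : nat) : 1 <= L ->
  L ^- (k * d) * \sum_(a : 'M['I_(2 * N + 1)]_(k, d)) mwt (latpt L a) <=
  (2 * pi) ^+ (k * d).
Proof.
move=> L1; have L0 : 0 < L by exact: lt_le_trans L1.
rewrite -exprVn sum_mx; under eq_bigr do rewrite latpt_vec_mx mwt_vec_mx.
by apply: grid_sum_rwt; rewrite ?invr_gt0 ?invf_le1.
Qed.

Lemma sum_prod_mx M k d (F : 'I_k -> 'I_d -> 'I_M -> R) :
  \sum_(a : 'M['I_M]_(k, d)) \prod_i \prod_j F i j (a i j) =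
  \prod_i \prod_j \sum_x F i j x.
Proof.
rewrite [RHS]pair_big/= bigA_distr_bigA/=.
rewrite (reindex (fun f : {ffun 'I_k * 'I_d -> 'I_M} => \matrix_(i, j) f (i, j)))/=.
  apply: eq_bigr => f _; rewrite pair_big/=; apply: eq_bigr => -[i j] _.
  by rewrite mxE.
exists (fun a : 'M['I_M]_(k, d) => [ffun ij => a ij.1 ij.2]) => [f _|a _].
  by apply/ffunP => -[i j]; rewrite ffunE mxE.
by apply/matrixP => i j; rewrite mxE ffunE.
Qed.

(* A hyperplane condition with nonzero [i0]-th coefficient determines row [i0]
   of a lattice point from the other rows: overwriting that row by a constant
   is injective on the hyperplane, which saves a factor [L ^- d]. *)
Lemma sum_hyperplane_le k d (c0 : R) (c : 'I_k -> R) (i0 : 'I_k) (s : 'rV[R]_d)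
    (L : R) (N : nat) : 1 <= L -> c i0 != 0 ->
  L ^- (k * d) * \sum_(a : 'M['I_(2 * N + 1)]_(k, d) |
      c0 *: s + \sum_i c i *: row i (latpt L a) == 0) mwt (latpt L a) <=
  ((2 * pi) ^+ d) ^+ k.-1 * L ^- d.
Proof.
move=> L1 ci0; have L0 : 0 < L by exact: lt_le_trans L1.
have h0 : 0 < L^-1 by rewrite invr_gt0.
have h1 : L^-1 <= 1 by rewrite invf_le1.
have lt0 : (0 < 2 * N + 1)%N by rewrite addn1.
pose o := Ordinal lt0; pose pt (x : 'I_(2 * N + 1)) : R := (x%:R - N%:R) / L.
have pt_inj : injective pt.
  move=> x y /(mulIf (lt0r_neq0 h0)) /addIr /eqP.
  by rewrite eqr_nat => /eqP; exact: val_inj.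
pose r (a : 'M['I_(2 * N + 1)]_(k, d)) := \matrix_(i, l) if i == i0 then o else a i l.
(* In row [i0] the weight becomes the indicator of [o]. As [wt] is at most 1, [Phi (r a)] dominates
   the weight of a, while row [i0] sums to 1 in each coordinate. *)
pose F (i : 'I_k) (l : 'I_d) x : R := if i == i0 then (x == o)%:R else wt (pt x).
pose Phi (b : 'M['I_(2 * N + 1)]_(k, d)) := \prod_i \prod_l F i l (b i l).
have F0 i l x : 0 <= F i l x by rewrite /F; case: ifP => // _; exact: wt_ge0.
have Phi0 b : 0 <= Phi b by apply: prodr_ge0 => i _; apply: prodr_ge0 => l _.
pose P (a : 'M['I_(2 * N + 1)]_(k, d)) := c0 *: s + \sum_i c i *: row i (latpt L a) == 0.
rewrite (eq_bigl P)//.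
have r_inj : {in P &, injective r}.
  move=> a b /eqP Pa /eqP Pb rab.
  have ab i l : i != i0 -> a i l = b i l.
    by move=> /negbTE ii0; have /matrixP/(_ i l) := rab; rewrite !mxE ii0.
  (* The other rows agree, so equating the two hyperplane equations leaves only row [i0], and [c i0]
     can be cancelled. *)
  have : c i0 *: row i0 (latpt L a) = c i0 *: row i0 (latpt L b).
    have e : \sum_(i | i != i0) c i *: row i (latpt L a) =
             \sum_(i | i != i0) c i *: row i (latpt L b).
      apply: eq_bigr => i ii0; congr (_ *: _).
      by apply/rowP => l; rewrite !mxE ab.
    rewrite (bigD1 i0)//= e in Pa; rewrite (bigD1 i0)//= in Pb.
    by move: (etrans Pa (esym Pb)) => /addrI /addIr.
  move/(scalerI ci0)/rowP => e; apply/matrixP => i l.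
  have [->|] := eqVneq i i0; last exact: ab.
  by have := e l; rewrite !mxE; exact: pt_inj.
have step1 : \sum_(a | P a) mwt (latpt L a) <= \sum_b Phi b.
  apply: (@le_trans _ _ (\sum_(a | P a) Phi (r a))).
    apply: ler_sum => a _; apply: ler_prod => i _; rewrite prodr_ge0/=; last first.
      by move=> *; exact: wt_ge0.
    apply: ler_prod => l _; rewrite wt_ge0 /F !mxE/=.
    have [_|//] := eqVneq i i0; rewrite eqxx /wt invf_le1 ?wt_den_gt0// lerDl.
    exact: sqr_ge0.
  (* By injectivity the sum runs over the image of [r], a part of the sum over all b. *)
  rewrite -(big_imset _ r_inj)/= [leRHS](bigID (mem (r @: P)))/= lerDl.
  by apply: sumr_ge0 => b _.
apply: (@le_trans _ _ (L ^- (k * d) * \sum_b Phi b)).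
  by apply: ler_wpM2l => //; rewrite -exprVn exprn_ge0// ltW.
(* One factor 1/L goes to each entry: entries outside row [i0] give at most 2 pi, those of row [i0]
   exactly 1/L. *)
have -> : L ^- (k * d) * (\sum_b Phi b) =
    \prod_(i < k) \prod_(l < d) (L^-1 * \sum_x F i l x).
  rewrite sum_prod_mx -exprVn mulnC exprM powE -big_split; apply: eq_bigr => i _.
  by rewrite powE -big_split.
rewrite (bigD1 i0)//= mulrC; apply: ler_pM.
- by do 2!apply: prodr_ge0 => ? _; apply: mulr_ge0; [exact: ltW|exact: sumr_ge0].
- by apply: prodr_ge0 => ? _; apply: mulr_ge0; [exact: ltW|exact: sumr_ge0].
- have -> : ((2 * pi) ^+ d) ^+ k.-1 = \prod_(i < k | i != i0) \prod_(l < d) (2 * pi) :> R.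
    by rewrite -powE prodr_const cardC1 card_ord.
  apply: ler_prod => i ii0; apply/andP; split.
    by apply: prodr_ge0 => ? _; apply: mulr_ge0; [exact: ltW|exact: sumr_ge0].
  apply: ler_prod => l _; apply/andP; split.
    by apply: mulr_ge0; [exact: ltW|exact: sumr_ge0].
  by rewrite /F (negbTE ii0); exact: grid_sum_wt.
- rewrite -exprVn powE; apply: ler_prod => l _; apply/andP; split.
    by apply: mulr_ge0; [exact: ltW|exact: sumr_ge0].
  rewrite /F eqxx (bigD1 o)//= ?eqxx big1 ?addr0 ?mulr1//.
  by move=> x /negbTE ->.
Qed.

End lattice.

(** * Excluded points, the limit of growing boxes, and measurability of the lattice sum *)

Section lattice_limit.
Set Implicit Arguments. Unset Strict Implicit.
Context {R : realType}.

(** A union bound over the p hyperplanes. *)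
Lemma sum_inD_le k d p (c0 : 'I_p -> R) (c : 'I_p -> 'I_k -> R) (s : 'rV[R]_d)
    (L : R) (N : nat) : 1 <= L -> (forall j, exists i, c j i != 0) ->
  L ^- (k * d) * \sum_(a : 'M['I_(2 * N + 1)]_(k, d) | inD c0 c s (latpt L a))
      mwt (latpt L a) <=
  p%:R * ((2 * pi) ^+ d) ^+ k.-1 * L ^- d.
Proof.
move=> L1 hc; have L0 : 0 < L by exact: lt_le_trans L1.
pose P j (a : 'M['I_(2 * N + 1)]_(k, d)) :=
  c0 j *: s + \sum_i c j i *: row i (latpt L a) == 0.
have le1 : \sum_(a : 'M['I_(2 * N + 1)]_(k, d) | inD c0 c s (latpt L a)) mwt (latpt L a)
    <= \sum_j \sum_(a | P j a) mwt (latpt L a).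
  rewrite (exchange_big_dep xpredT)//= big_mkcond/=; apply: ler_sum => a _.
  case: ifP => [/existsP[j Pj]|_]; last by apply: sumr_ge0 => j _; exact: mwt_ge0.
  by rewrite (bigD1 j)//= lerDl; apply: sumr_ge0 => i _; exact: mwt_ge0.
have Lk : 0 <= L ^- (k * d) by rewrite -exprVn exprn_ge0// invr_ge0 ltW.
apply: (le_trans (ler_wpM2l Lk le1)).
have -> : p%:R * ((2 * pi) ^+ d) ^+ k.-1 * L ^- d =
    \sum_(j < p) ((2 * pi) ^+ d) ^+ k.-1 * L ^- d.
  by rewrite sumr_const card_ord -[RHS]mulr_natl mulrA.
rewrite mulr_sumr; apply: ler_sum => j _; have [i0 ci0] := hc j.
exact: sum_hyperplane_le ci0.
Qed.

Lemma lattice_sum_nondecreasing k d (phi : 'M[R]_(k, d) -> R) (L : R) :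
  (forall z, 0 <= phi z) ->
  nondecreasing_seq
    (fun N => \sum_(a : 'M['I_(2 * N + 1)]_(k, d)) phi (latpt L a)).
Proof.
move=> phi0; apply/nondecreasing_seqP => N.
have lt1 (x : 'I_(2 * N + 1)) : (x.+1 < 2 * N.+1 + 1)%N.
  by apply: (leq_ltn_trans (ltn_ord x)); rewrite ltn_add2r ltn_pmul2l.
(* The centre of the box moves from index N to N + 1, so a shift by one keeps the lattice point. *)
pose e (x : 'I_(2 * N + 1)) := Ordinal (lt1 x).
have e_inj : injective (fun a : 'M['I_(2 * N + 1)]_(k, d) => map_mx e a).
  move=> a b /matrixP ab; apply/matrixP => i j; apply/val_inj.
  by have := ab i j; rewrite !mxE => /(congr1 val) [].
have -> : \sum_(a : 'M['I_(2 * N + 1)]_(k, d)) phi (latpt L a) =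
    \sum_(a : 'M['I_(2 * N + 1)]_(k, d)) phi (latpt L (map_mx e a)).
  apply: eq_bigr => a _; congr phi; apply/matrixP => i j; rewrite !mxE/=.
  by rewrite -!natr1; congr (_ / _); ring.
rewrite -(big_imset (fun b => phi (latpt L b)) (in2W e_inj))/=.
rewrite [leRHS](bigID (mem [set map_mx e a | a : 'M['I_(2 * N + 1)]_(k, d)]))/=.
by rewrite lerDl sumr_ge0.
Qed.

Lemma cvg_lattice_sum k d (phi : 'M[R]_(k, d) -> R) (L A : R) :
  1 <= L -> (forall z, 0 <= phi z <= A * mwt z) ->
  cvgn (fun N => \sum_(a : 'M['I_(2 * N + 1)]_(k, d)) phi (latpt L a)).
Proof.
move=> L1 phiA; have L0 : 0 < L by exact: lt_le_trans L1.
have A0 : 0 <= A.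
  by have /andP[a b] := phiA 0; rewrite -(pmulr_lge0 _ (mwt_gt0 (0 : 'M[R]_(k, d)))) (le_trans a b).
apply: nondecreasing_is_cvgn.
  by apply: lattice_sum_nondecreasing => z; have /andP[] := phiA z.
exists (A * (L ^+ (k * d) * (2 * pi) ^+ (k * d))) => _ [N _ <-].
apply: (@le_trans _ _ (\sum_(a : 'M['I_(2 * N + 1)]_(k, d)) A * mwt (latpt L a))).
  by apply: ler_sum => a _; have /andP[] := phiA (latpt L a).
rewrite -mulr_sumr; apply: ler_wpM2l => //.
by rewrite mulrC -ler_pdivrMr ?exprn_gt0// mulrC; exact: sum_mwt_le.
Qed.

(* The excluded points are cut out of [|g|] and of [|g| - g], which are both
   nonnegative, so that monotone convergence applies. *)
Lemma cvg_latsum k d p (c0 : 'I_p -> R) (c : 'I_p -> 'I_k -> R) (s : 'rV[R]_d)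
    (L A : R) (g : 'M[R]_(k, d) -> R) : 1 <= L ->
  (forall z, `|g z| <= A * mwt z) -> cvgn (latsum_N c0 c s L g).
Proof.
move=> L1 gA.
pose phi1 z := if ~~ inD c0 c s z then `|g z| else 0.
pose phi2 z := if ~~ inD c0 c s z then `|g z| - g z else 0.
have Am0 (z : 'M[R]_(k, d)) : 0 <= A * mwt z by exact: (le_trans (normr_ge0 _) (gA z)).
have -> : latsum_N c0 c s L g = (fun N =>
    \sum_(a : 'M['I_(2 * N + 1)]_(k, d)) phi1 (latpt L a) -
    \sum_(a : 'M['I_(2 * N + 1)]_(k, d)) phi2 (latpt L a)).
  apply/funext => N; rewrite /latsum_N big_mkcond -sumrB; apply: eq_bigr => a _.
  by rewrite /phi1 /phi2; case: ifP => _; [rewrite opprB addrC subrK|rewrite subr0].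
apply: is_cvgB.
  apply: (@cvg_lattice_sum _ _ _ _ A) => // z; rewrite /phi1; case: ifP => _.
    by rewrite normr_ge0 gA.
  by rewrite lexx Am0.
apply: (@cvg_lattice_sum _ _ _ _ (2 * A)) => // z; rewrite /phi2 -mulrA; case: ifP => _.
  have := ler_norm (g z); have := gA z; have := ler_norm (- g z); rewrite normrN.
  by move=> *; apply/andP; split; lra.
by rewrite lexx mulr_ge0.
Qed.

(** For each box the error is the grid error plus the weight of the excluded points; the tail
    vanishes as the box grows. *)
Lemma latsum_Rint_mx k d p (c0 : 'I_p -> R) (c : 'I_p -> 'I_k -> R) (s : 'rV[R]_d)
    (L A B : R) (g : 'M[R]_(k, d) -> R) :
  (2 <= d)%N -> (forall j, exists i, c j i != 0) ->
  1 <= L -> measurable_row (fun v => g (vec_mx v)) ->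
  (forall z, `|g z| <= A * mwt z) -> C2 g ->
  (forall a z, `|pd a (pd a g) z| <= B * mwt z) -> 0 <= B ->
  `|L ^- (k * d) * latsum c0 c s L g - Rint_mx g| <=
  ((k * d)%:R * (2 * pi) ^+ (k * d) * B + p%:R * ((2 * pi) ^+ d) ^+ k.-1 * A) * L ^- 2.
Proof.
move=> d2 hc L1 mg gA gC2 gB B0; have L0 : 0 < L by exact: lt_le_trans L1.
have h0 : 0 < L^-1 by rewrite invr_gt0.
have h1 : L^-1 <= 1 by rewrite invf_le1.
have A0 : 0 <= A.
  by rewrite -(pmulr_lge0 _ (mwt_gt0 (0 : 'M[R]_(k, d)))); exact: (le_trans (normr_ge0 _) (gA 0)).
have Lk : 0 <= L ^- (k * d) by rewrite -exprVn exprn_ge0// ltW.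
set K1 := _ * (2 * pi) ^+ (k * d); set K2 := p%:R * _.
have K20 : 0 <= K2 by rewrite mulr_ge0// !exprn_ge0// mulr_ge0// pi_ge0.
have step N : `|L ^- (k * d) * latsum_N c0 c s L g N - Rint_mx g| <=
    K1 * (B * L ^- 2 + A * tail L^-1 N) + A * (K2 * L ^- 2).
  have full := lattice_sum_Rint_mx N L1 mg gA gC2 gB B0.
  rewrite -/K1 in full.
  have excl : `|L ^- (k * d) * latsum_N c0 c s L g N -
      L ^- (k * d) * \sum_(a : 'M['I_(2 * N + 1)]_(k, d)) g (latpt L a)| <=
      A * (K2 * L ^- 2).
    (* The admissible points cancel, leaving minus the sum over the excluded ones. *)
    rewrite -mulrBr (bigID (fun a => inD c0 c s (latpt L a)))/= -/(latsum_N c0 c s L g N).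
    rewrite opprD addrCA subrr addr0 normrM normrN (ger0_norm Lk).
    apply: (@le_trans _ _ (A * (L ^- (k * d) *
       \sum_(a : 'M['I_(2 * N + 1)]_(k, d) | inD c0 c s (latpt L a)) mwt (latpt L a)))).
      rewrite mulrCA; apply: ler_wpM2l => //; apply: (le_trans (ler_norm_sum _ _ _)).
      by rewrite mulr_sumr; apply: ler_sum.
    apply: ler_wpM2l => //; apply: (le_trans (sum_inD_le _ _ _ L1 hc)).
    (* Here d >= 2 and 1/L <= 1 turn L^-d into L^-2. *)
    apply: ler_wpM2l => //; rewrite -!exprVn; apply: ler_wiXn2l => //; exact: ltW.
  rewrite -(subrK (L ^- (k * d) * \sum_(a : 'M['I_(2 * N + 1)]_(k, d)) g (latpt L a))
    (L ^- (k * d) * latsum_N c0 c s L g N)) -addrA addrC.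
  apply: (le_trans (ler_normD _ _)); exact: lerD.
have cS := cvg_latsum (c0 := c0) (c := c) (s := s) L1 gA.
have -> : (K1 * B + K2 * A) * L ^- 2 = K1 * (B * L ^- 2 + A * 0) + A * (K2 * L ^- 2) by ring.
apply: (ler_cvg_to (a := \oo) (f := fun N => `|L ^- (k * d) * latsum_N c0 c s L g N - Rint_mx g|)
  (g := fun N => K1 * (B * L ^- 2 + A * tail L^-1 N) + A * (K2 * L ^- 2))).
- apply: cvg_norm; apply: cvgB; last exact: cvg_cst.
  by apply: cvgM; first exact: cvg_cst.
- apply: cvgD; last exact: cvg_cst.
  apply: cvgM; first exact: cvg_cst.
  apply: cvgD; first exact: cvg_cst.
  by apply: cvgM; [exact: cvg_cst|exact: cvg_tail].
- by apply: nearW.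
Qed.

(** A pointwise limit of finite sums, each term being measurable in t at its fixed lattice point. *)
Lemma measurable_latsum k d p (c0 : 'I_p -> R) (c : 'I_p -> 'I_k -> R) (s : 'rV[R]_d)
    (L : R) dT (T : measurableType dT) (g : T -> 'M[R]_(k, d) -> R) (A : T -> R) :
  1 <= L -> (forall z, measurable_fun setT (g ^~ z)) ->
  (forall t z, `|g t z| <= A t * mwt z) ->
  measurable_fun setT (fun t => latsum c0 c s L (g t)).
Proof.
move=> L1 mg gA.
apply: (measurable_fun_cvg (h := fun N t => latsum_N c0 c s L (g t) N)) => [N|t _].
  rewrite (_ : (fun t => _) = fun t => \sum_(a : 'M['I_(2 * N + 1)]_(k, d))
      if ~~ inD c0 c s (latpt L a) then g t (latpt L a) else 0); last first.
    by apply/funext => t; rewrite /latsum_N big_mkcond.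
  by apply: measurable_sum => a; case: (inD c0 c s (latpt L a)) => /=;
    [exact: measurable_cst|exact: mg].
exact: cvg_latsum L1 (gA t).
Qed.

Lemma mx_of_tuple_vec_mx p q (t : (p * q).-tuple R) : mx_of_tuple t = vec_mx (row_of_tuple t).
Proof. by apply/matrixP => i j; rewrite !mxE. Qed.

Lemma meas3_section k d m (g : 'M[R]_(k, d) -> 'rV[R]_m -> R -> R) (nu : R) :
  meas3 g -> nuI nu ->
  measurable_fun setT (fun x : (k * d).-tuple R * m.-tuple R =>
    g (vec_mx (row_of_tuple x.1)) (row_of_tuple x.2) nu).
Proof.
move=> mg hnu; under eq_fun do rewrite -mx_of_tuple_vec_mx.
apply: (measurable_comp (F := [set x | nuI x.2]) _ _ mg (g := fun x => (x, nu))).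
- rewrite -[X in measurable X]setTI.
  exact: (@measurable_snd _ _ ((k * d).-tuple R * m.-tuple R)%type R measurableT _
    (measurable_itv `]0, 2^-1]%R)).
- by move=> _ [x _ <-].
- by apply: measurable_fun_pair => //; exact: measurable_cst.
Qed.

End lattice_limit.

(** * Closure properties of the majorants *)

Section Csharp_closure.
Set Implicit Arguments. Unset Strict Implicit.
Context {R : realType}.

Lemma CsharpD p q (C D : 'M[R]_(p, q) -> R) :
  Csharp C -> Csharp D -> Csharp (fun x => C x + D x).
Proof.
move=> [cC [C0 CN]] [cD [D0 DN]]; split; last split.
- by move=> x; exact: (cvgD (cC x) (cD x)).
- by move=> x; rewrite addr_ge0.
- move=> N; have [c hc] := CN N; have [d hd] := DN N; exists (c + d) => x.
  by rewrite mulrDl lerD.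
Qed.

Lemma CsharpZ p q (C : 'M[R]_(p, q) -> R) (M : R) :
  0 <= M -> Csharp C -> Csharp (fun x => M * C x).
Proof.
move=> M0 [cC [C0 CN]]; split; last split.
- by move=> x; exact: (cvgM (cvg_cst M) (cC x)).
- by move=> x; rewrite mulr_ge0.
- by move=> N; have [c hc] := CN N; exists (M * c) => x; rewrite -mulrA ler_wpM2l.
Qed.

Lemma Csharp_sum p q (I : Type) (r : seq I) (C : I -> 'M[R]_(p, q) -> R) :
  (forall i, Csharp (C i)) -> Csharp (fun x => \sum_(i <- r) C i x).
Proof.
move=> hC; elim: r => [|i r IHr].
  rewrite (_ : (fun x => _) = fun=> 0); last by apply/funext => x; rewrite big_nil.
  split; first exact: cst_continuous.
  by split=> // N; exists 0 => x; rewrite mul0r.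
rewrite (_ : (fun x => _) = fun x => C i x + \sum_(j <- r) C j x); first exact: CsharpD.
by apply/funext => x; rewrite big_cons.
Qed.

(** Replaces the majorants in z and theta by product weights, keeping one majorant in s. It serves G
    with w = 1 and its second derivatives with w = nu^-2. *)
Lemma Csharp_absorb p q p1 q1 m (I : Type)
    (F : 'M[R]_(p, q) -> 'M[R]_(p1, q1) -> 'rV[R]_m -> I -> R) (P : I -> Prop) (w : I -> R) :
  (forall i, P i -> 0 <= w i) ->
  (exists C1 C2 C3, [/\ Csharp C1, Csharp C2, Csharp C3 &
     forall s z th i, P i -> `|F s z th i| <= w i * (C1 s * C2 z * C3 th)]) ->
  exists2 C, Csharp C & forall s z th i, P i ->
    `|F s z th i| <= w i * (C s * mwt z * rwt th).
Proof.
move=> w0 [C1 [C2 [C3 [h1 h2 h3 hF]]]].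
have [M2 M20 b2] := Csharp_le_mwt h2; have [M3 M30 b3] := Csharp_le_mwt h3.
exists (fun s => M2 * M3 * C1 s); first by apply: CsharpZ => //; exact: mulr_ge0.
move=> s z th i Pi; apply: (le_trans (hF s z th i Pi)); apply: ler_wpM2l; first exact: w0.
have [_ [C10 _]] := h1; have [_ [C20 _]] := h2; have [_ [C30 _]] := h3.
have -> : M2 * M3 * C1 s * mwt z * rwt th = C1 s * (M2 * mwt z) * (M3 * rwt th) by ring.
apply: ler_pM => //; first exact: mulr_ge0.
  exact: ler_wpM2l.
by rewrite -mwt_row.
Qed.

End Csharp_closure.

(** * Integration over theta and the final estimate *)

Theorem theorem3p1 (R : realType) (d k m p : nat)
  (hd : (2 <= d)%N) (hk : (1 <= k)%N)
  (c0 : 'I_p -> R) (c : 'I_p -> 'I_k -> R)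
  (hc : forall j : 'I_p, exists i : 'I_k, c j i != 0)
  (G : 'rV[R]_d -> 'M[R]_(k, d) -> 'rV[R]_m -> R -> R)
  (hmeas : forall s, meas3 (G s))
  (hC2 : forall s th nu, nuI nu -> C2 (fun z => G s z th nu))
  (hb0 : exists (C1 : 'rV[R]_d -> R) (C2' : 'M[R]_(k, d) -> R) (C3 : 'rV[R]_m -> R),
     [/\ Csharp C1, Csharp C2', Csharp C3 &
      forall s z th nu, nuI nu -> `|G s z th nu| <= C1 s * C2' z * C3 th])
  (hb1 : forall a : 'I_k * 'I_d,
     exists (C1 : 'rV[R]_d -> R) (C2' : 'M[R]_(k, d) -> R) (C3 : 'rV[R]_m -> R),
     [/\ Csharp C1, Csharp C2', Csharp C3 &
      forall s z th nu, nuI nu ->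
        `|pd a (fun z' => G s z' th nu) z| <= nu^-1 * (C1 s * C2' z * C3 th)])
  (hb2 : forall a b : 'I_k * 'I_d,
     exists (C1 : 'rV[R]_d -> R) (C2' : 'M[R]_(k, d) -> R) (C3 : 'rV[R]_m -> R),
     [/\ Csharp C1, Csharp C2', Csharp C3 &
      forall s z th nu, nuI nu ->
        `|pd a (pd b (fun z' => G s z' th nu)) z| <= nu ^- 2 * (C1 s * C2' z * C3 th)]) :
  exists C : 'rV[R]_d -> R, Csharp C /\
    forall (L nu : R) (s : 'rV[R]_d), 1 <= L -> nuI nu ->
      `|S_s c0 c G s nu L - J_s G s nu| <= C s * nu ^- 2 * L ^- 2.
Proof.
have [C hC hG] : exists2 C, Csharp C & forall s z th nu, nuI nu ->
    `|G s z th nu| <= 1 * (C s * mwt z * rwt th).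
  apply: (Csharp_absorb (w := fun=> 1) (P := @nuI R)) => //.
  have [C1 [C2' [C3 [h1 h2 h3 h]]]] := hb0; exists C1, C2', C3; split => // s z th nu hnu.
  by rewrite mul1r; exact: h.
pose P (a : 'I_k * 'I_d) Da := Csharp Da /\ forall s z th nu, nuI nu ->
  `|pd a (pd a (fun z' => G s z' th nu)) z| <= nu ^- 2 * (Da s * mwt z * rwt th).
(* One majorant per coordinate for the pure second derivative; their sum [Dsum] serves all
   coordinates at once. *)
have [D hD] : {D & forall a, P a (D a)}.
  apply: choice => a.
  have [|Da hDa b] := Csharp_absorb (w := fun nu => nu ^- 2) (P := @nuI R) _ (hb2 a a).
    by move=> nu _; rewrite -exprVn sqr_ge0.
  by exists Da.
pose Dsum s := \sum_a D a s.
have hDsum : Csharp Dsum by apply: Csharp_sum => a; case: (hD a).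
have D0 a s : 0 <= D a s by have [[_ [+ _]] _] := hD a; apply.
have C0 s : 0 <= C s by case: hC => _ [].
pose K1 : R := (k * d)%:R * (2 * pi) ^+ (k * d).
pose K2 : R := p%:R * ((2 * pi) ^+ d) ^+ k.-1.
have K10 : 0 <= K1 by rewrite mulr_ge0// exprn_ge0// mulr_ge0// pi_ge0.
have K20 : 0 <= K2 by rewrite mulr_ge0// !exprn_ge0// mulr_ge0// pi_ge0.
(* [K1] comes from the midpoint error, [K2] from the excluded points, pi^m from the
   theta-integration. *)
exists (fun s => pi ^+ m * (K1 * Dsum s + K2 * C s)); split.
  apply: CsharpZ; first exact: exprn_ge0 (pi_ge0 R).
  by apply: CsharpD; exact: CsharpZ.
move=> L nu s L1 hnu.
have mG := meas3_section (hmeas s) hnu.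
have bG th z : `|G s z th nu| <= C s * rwt th * mwt z.
  by have := hG s z th nu hnu; rewrite mul1r mulrAC.
have cell th : `|L ^- (k * d) * latsum c0 c s L (fun z => G s z th nu) -
    Rint_mx (fun z => G s z th nu)| <=
    (K1 * Dsum s + K2 * C s) * nu ^- 2 * L ^- 2 * rwt th.
  (* The contribution of the excluded points carries no power of nu; this inequality lets it absorb
     nu^-2. *)
  have nu2 : 1 <= nu ^- 2.
    move: hnu; rewrite /nuI/= in_itv/= => /andP[n0 n1].
    by rewrite -exprVn exprn_ege1// invf_ge1//; lra.
  (* With theta fixed, its weight is part of the constants A and B. *)
  have := @latsum_Rint_mx R k d p c0 c s L (C s * rwt th) (nu ^- 2 * Dsum s * rwt th)
    (fun z => G s z th nu) hd hc L1.
  rewrite -/K1 -/K2 => /(_ _ (bG th) (hC2 s th nu hnu)) H.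
  apply: le_trans (H _ _ _) _.
  - have [t <-] := row_of_tuple_surj th.
    exact: (measurableT_comp mG (measurable_fun_pair (@measurable_id _ _ setT) (measurable_cst t))).
  - move=> a z; have [_ hDa] := hD a; apply: (le_trans (hDa s z th nu hnu)).
    rewrite -!mulrA; apply: ler_wpM2l; first exact: le_trans ler01 nu2.
    rewrite [rwt th * _]mulrC !mulrA; apply: ler_wpM2r; first exact: rwt_ge0.
    apply: ler_wpM2r; first exact: mwt_ge0.
    by rewrite /Dsum (bigD1 a)//= lerDl sumr_ge0.
  - apply: mulr_ge0; last exact: rwt_ge0.
    by apply: mulr_ge0; [exact: le_trans ler01 nu2|exact: sumr_ge0].
  - have -> : (K1 * Dsum s + K2 * C s) * nu ^- 2 * L ^- 2 * rwt th =
      (K1 * (nu ^- 2 * Dsum s * rwt th) + nu ^- 2 * (K2 * (C s * rwt th))) * L ^- 2 by ring.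
    apply: ler_wpM2r; first by rewrite -exprVn sqr_ge0.
    rewrite lerD2l; apply: ler_peMl => //; apply: mulr_ge0 => //; apply: mulr_ge0 => //.
    exact: rwt_ge0.
have mJ : measurable_row (fun th => Rint_mx (fun z => G s z th nu)).
  apply: (measurable_Rint_n (F := fun t v => G s (vec_mx v) (row_of_tuple t) nu)).
  (* [mG] lists z before theta; the swap makes theta the parameter. *)
  exact: (measurableT_comp mG (measurable_fun_pair measurable_snd measurable_fst)).
have bJ th : `|Rint_mx (fun z => G s z th nu)| <= C s * pi ^+ (k * d) * rwt th.
  rewrite mulrAC; apply: Rint_n_bound.
    have [t <-] := row_of_tuple_surj th.
    exact: (measurableT_comp mG (measurable_fun_pair (@measurable_id _ _ setT) (measurable_cst t))).
  by move=> v; rewrite -mwt_vec_mx.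
have mS : measurable_row (fun th => L ^- (k * d) * latsum c0 c s L (fun z => G s z th nu)).
  apply: measurable_funM; first exact: measurable_cst.
  apply: (@measurable_latsum R k d p c0 c s L _ (m.-tuple R)
    (fun t z => G s z (row_of_tuple t) nu) (fun t => C s * rwt (row_of_tuple t))) => // z.
  rewrite -[z]mxvecK; have [t <-] := row_of_tuple_surj (mxvec z).
  exact: (measurableT_comp mG (measurable_fun_pair (measurable_cst t) (@measurable_id _ _ setT))).
(* A crude bound by the triangle inequality, supplying the domination that [Rint_nB] requires. *)
have bS th : `|L ^- (k * d) * latsum c0 c s L (fun z => G s z th nu)| <=
    ((K1 * Dsum s + K2 * C s) * nu ^- 2 * L ^- 2 + C s * pi ^+ (k * d)) * rwt th.
  rewrite mulrDl -[X in `|X|](subrK (Rint_mx (fun z => G s z th nu))).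
  exact: le_trans (ler_normD _ _) (lerD (cell th) (bJ th)).
rewrite /S_s /J_s -(Rint_nB mS mJ bS bJ).
have -> : pi ^+ m * (K1 * Dsum s + K2 * C s) * nu ^- 2 * L ^- 2 =
  (K1 * Dsum s + K2 * C s) * nu ^- 2 * L ^- 2 * pi ^+ m by ring.
apply: Rint_n_bound cell.
exact: measurable_funB mS mJ.
Qed.
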